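(* Let $\lambda$ be a nonzero real number. For all integers $n\ge 0$, $$K_{n,\lambda}(x)=n!\sum_{k=0}^{n}\frac{1}{k!}J_{k,\lambda}(x).$$
   Context: All identities are between polynomials in an indeterminate $x$ with real coefficients. For nonzero real $\lambda$, $(x)_{0,\lambda}=1$ and $(x)_{k,\lambda}=x(x-\lambda)(x-2\lambda)\cdots(x-(k-1)\lambda)$ for $k\ge 1$. For $n\ge 0$, $K_{n,\lambda}(x)=n!\sum_{k=0}^{n}\binom{n+k+1}{n-k}\frac{(x)_{k,\lambda}}{k!}$, and $J_{n,\lambda}(x)=K_{n,\lambda}(x)-nK_{n-1,\lambda}(x)$, where for $n=0$ the second term is read as $0$, so $J_{0,\lambda}(x)=1$. *)

(* Defs.v *)
From mathcomp Require Import all_boot all_order all_algebra.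
From mathcomp Require Import reals.

Set Implicit Arguments.
Unset Strict Implicit.
Unset Printing Implicit Defensive.

Import GRing.Theory.
Local Open Scope ring_scope.

(* (x)_{k,lam} = x (x - lam) (x - 2 lam) ... (x - (k - 1) lam) *)
Definition dfact (R : realType) (lam : R) (k : nat) : {poly R} :=
  \prod_(i < k) ('X - (i%:R * lam)%:P).

Definition Kpoly (R : realType) (lam : R) (n : nat) : {poly R} :=
  n`!%:R *: \sum_(k < n.+1)
    ('C(n + k + 1, n - k)%:R / k`!%:R) *: dfact lam k.

Definition Jpoly (R : realType) (lam : R) (n : nat) : {poly R} :=
  match n with
  | 0 => Kpoly lam 0
  | m.+1 => Kpoly lam m.+1 - m.+1%:R *: Kpoly lam m
  end.

(* Main.v *)
Require Import Defs.
From mathcomp Require Import all_boot all_order all_algebra.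
From mathcomp Require Import reals.

Import GRing.Theory.
Local Open Scope ring_scope.

(** The identity is a telescoping sum.  Dividing the recurrence
    J_k = K_k - k K_(k-1) by k! gives J_k / k! = K_k / k! - K_(k-1) / (k-1)!,
    so the polynomials J_k / k! are the successive differences of K_k / k!, with
    J_0 / 0! = K_0 / 0! as initial term; summing over k <= n leaves K_n / n!. *)

Lemma fact_natr_neq0 (R : realType) (n : nat) : n`!%:R != 0 :> R.
Proof. by rewrite Num.Theory.pnatr_eq0 -lt0n fact_gt0. Qed.

(** One step of the telescope: the factor k + 1 in the recurrence is exactly
    what turns 1 / (k + 1)! into 1 / k!. *)
Lemma Jpoly_div_fact (R : realType) (lam : R) (k : nat) :
  (k.+1`!%:R)^-1 *: Jpoly lam k.+1 =
  (k.+1`!%:R)^-1 *: Kpoly lam k.+1 - (k`!%:R)^-1 *: Kpoly lam k.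
Proof.
have k1_neq0 : k.+1%:R != 0 :> R by rewrite Num.Theory.pnatr_eq0.
have inv_factS : (k.+1`!%:R)^-1 * k.+1%:R = (k`!%:R)^-1 :> R.
  by rewrite factS natrM invfM mulrAC mulVf ?mul1r.
by rewrite -inv_factS -scalerA -scalerBr.
Qed.

Lemma sum_Jpoly_div_fact (R : realType) (lam : R) (n : nat) :
  \sum_(k < n.+1) (k`!%:R)^-1 *: Jpoly lam k = (n`!%:R)^-1 *: Kpoly lam n.
Proof.
elim: n => [|n IHn]; first by rewrite big_ord1.
by rewrite big_ord_recr /= IHn Jpoly_div_fact addrC subrK.
Qed.

Theorem theorem4p1 (R : realType) (lam : R) (hlam : lam != 0) (n : nat) :
  Kpoly lam n = n`!%:R *: \sum_(k < n.+1) (k`!%:R)^-1 *: Jpoly lam k.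
Proof.
by rewrite sum_Jpoly_div_fact scalerA mulfV ?scale1r // fact_natr_neq0.
Qed.
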